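(* Let $n\ge 2$ and let $\mathcal{L}\in\mathbb{R}^{n\times n}$ be the Laplacian of a strongly connected, weight-balanced directed graph on the node set $[n]=\{1,\dots,n\}$. Let $\mathcal{L}^{\dagger}_s:=\tfrac12\bigl(\mathcal{L}^{\dagger}+(\mathcal{L}^{\dagger})^{\top}\bigr)$, let $(\mathcal{L}^{\dagger}_s)^{\dagger}$ be its Moore–Penrose pseudoinverse, let $\bm{\zeta}:=\operatorname{diagvec}(\mathcal{L}^{\dagger}_s)\in\mathbb{R}^n$, and let $\Omega\in\mathbb{R}^{n\times n}$ be the resistance matrix with entries $\Omega_{ab}=(\bm{1}_a-\bm{1}_b)^{\top}\mathcal{L}^{\dagger}_s(\bm{1}_a-\bm{1}_b)$ for $a,b\in[n]$. Define $$\bm{p}:=\tfrac12(\mathcal{L}^{\dagger}_s)^{\dagger}\bm{\zeta}+\tfrac1n\bm{1},\qquad \sigma^2:=\tfrac14\bm{\zeta}^{\top}(\mathcal{L}^{\dagger}_s)^{\dagger}\bm{\zeta}+\tfrac1n\bm{1}^{\top}\bm{\zeta}.$$ Then $$\begin{bmatrix}0&\bm{1}^{\top}\\ \bm{1}&\Omega\end{bmatrix}^{-1}=-\frac12\begin{bmatrix}4\sigma^2&-2\bm{p}^{\top}\\ -2\bm{p}&(\mathcal{L}^{\dagger}_s)^{\dagger}\end{bmatrix}.$$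
   Context: A directed graph on $[n]$ is given by a weighted adjacency matrix $\mathcal{A}\in\mathbb{R}^{n\times n}$ with $\mathcal{A}\ge 0$ entrywise and zero diagonal ($\mathcal{A}_{ij}>0$ means an edge from $i$ to $j$). Its Laplacian is $\mathcal{L}=\mathcal{D}-\mathcal{A}$, where $\mathcal{D}=\operatorname{diag}(\sum_j\mathcal{A}_{1j},\dots,\sum_j\mathcal{A}_{nj})$; thus $\mathcal{L}\bm{1}=\bm{0}$. The graph is strongly connected if there is a directed path between every ordered pair of nodes (equivalently $\mathcal{L}$ is irreducible), and weight-balanced if in-degree equals out-degree at every node, i.e. $\mathcal{L}^{\top}\bm{1}=\bm{0}$ as well. $\dagger$ denotes the Moore–Penrose pseudoinverse; $\bm{1}$ is the all-ones vector, $\bm{1}_i$ the $i$-th standard basis vector, and $\operatorname{diagvec}(X)$ the vector of diagonal entries of $X$. *)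

(* Defs.v *)
From HB Require Import structures.
From mathcomp Require Import all_boot all_order all_algebra.
From mathcomp Require Import reals.

Set Implicit Arguments.
Unset Strict Implicit.
Unset Printing Implicit Defensive.

Import Order.TTheory GRing.Theory Num.Theory.
Local Open Scope ring_scope.

Definition penrose (R : realFieldType) (m n : nat)
    (A : 'M[R]_(m, n)) (X : 'M[R]_(n, m)) : bool :=
  [&& A *m X *m A == A, X *m A *m X == X,
      (A *m X)^T == A *m X & (X *m A)^T == X *m A].

Lemma gram_unitmx (R : realFieldType) (r n : nat) (G : 'M[R]_(r, n)) :
  row_free G -> G *m G^T \in unitmx.
Proof.
move=> freeG; rewrite -row_free_unit.
have kerG (x : 'rV[R]_r) : x *m (G *m G^T) = 0 -> x = 0.
  move=> x0; apply: (row_free_inj freeG); rewrite mul0mx.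
  have : \tr ((x *m G) *m (x *m G)^T) = 0.
    by rewrite trmx_mul mulmxA -(mulmxA x) x0 mul0mx mxtrace0.
  rewrite /mxtrace big_ord1 mxE => s0.
  have trE (j : 'I_n) : (x *m G)^T j 0 = (x *m G) 0 j by rewrite mxE.
  have ge0 (j : 'I_n) : true -> 0 <= (x *m G) 0 j * (x *m G)^T j 0.
    by rewrite trE -expr2 sqr_ge0.
  apply/rowP => j; apply/eqP; rewrite [X in _ == X]mxE.
  move/eqP: s0; rewrite psumr_eq0 // => /allP /(_ j).
  by rewrite mem_index_enum => /(_ isT) /=; rewrite trE mulf_eq0 orbb.
rewrite -kermx_eq0; apply/eqP/row_matrixP => i.
by rewrite row0; apply: kerG; rewrite -row_mul mulmx_ker row0.
Qed.

Lemma penrose_exists (R : realFieldType) (m n : nat) (A : 'M[R]_(m, n)) :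
  exists X : 'M[R]_(n, m), penrose A X.
Proof.
move: (col_base A) (row_base A) (mulmx_base A) (row_base_free A) (col_base_full A).
move: (\rank A) => r F G <- freeG fullF {A}.
have uG : G *m G^T \in unitmx by apply: gram_unitmx.
have uF : F^T *m F \in unitmx.
  rewrite -{2}[F]trmxK; apply: gram_unitmx.
  by rewrite /row_free mxrank_tr.
set P := invmx (G *m G^T); set Q := invmx (F^T *m F).
have sP : P^T = P by rewrite trmx_inv trmx_mul trmxK.
have sQ : Q^T = Q by rewrite trmx_inv trmx_mul trmxK.
exists (G^T *m P *m (Q *m F^T)).
have AX : F *m G *m (G^T *m P *m (Q *m F^T)) = F *m Q *m F^T.
  by rewrite !mulmxA -(mulmxA F G) -(mulmxA F (G *m _)) mulmxV // mulmx1.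
have XA : (G^T *m P *m (Q *m F^T)) *m (F *m G) = G^T *m P *m G.
  by rewrite !mulmxA -(mulmxA _ F^T F) -(mulmxA _ Q) mulVmx // mulmx1.
rewrite /penrose AX XA; apply/and4P; split; apply/eqP.
- by rewrite !mulmxA -(mulmxA _ F^T F) -(mulmxA F Q) mulVmx // mulmx1.
- by rewrite !mulmxA -(mulmxA _ G G^T) -(mulmxA _ (G *m _) P) mulmxV // mulmx1.
- by rewrite !trmx_mul trmxK sQ mulmxA.
- by rewrite !trmx_mul trmxK sP mulmxA.
Qed.

Lemma penrose_unique (R : realFieldType) (m n : nat) (A : 'M[R]_(m, n))
    (X Y : 'M[R]_(n, m)) : penrose A X -> penrose A Y -> X = Y.
Proof.
move=> /and4P[/eqP x1 /eqP x2 /eqP x3 /eqP x4].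
move=> /and4P[/eqP y1 /eqP y2 /eqP y3 /eqP y4].
have AXY : A *m X = A *m Y.
  by rewrite -{1}y1 -mulmxA -{1}y3 -{1}x3 -trmx_mul mulmxA x1 y3.
have XYA : X *m A = Y *m A.
  by rewrite -{1}y1 -!mulmxA mulmxA -{1}x4 -y4 -trmx_mul -mulmxA (mulmxA A) x1 y4.
by rewrite -x2 XYA -mulmxA AXY mulmxA y2.
Qed.

(* The Moore-Penrose pseudoinverse; not to be confused with the library's
   pinvmx, which need not satisfy the two symmetry conditions. *)
Definition mpinv (R : realFieldType) (m n : nat) (A : 'M[R]_(m, n)) :
    'M[R]_(n, m) :=
  xchoose (penrose_exists A).

Lemma mpinvP (R : realFieldType) (m n : nat) (A : 'M[R]_(m, n)) :
  penrose A (mpinv A).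
Proof. exact: xchooseP. Qed.

Definition weighted_digraph (R : realFieldType) (n : nat) (A : 'M[R]_n) : Prop :=
  (forall i j, 0 <= A i j) /\ (forall i, A i i = 0).

Definition edge (R : realFieldType) (n : nat) (A : 'M[R]_n) : rel 'I_n :=
  [rel i j | 0 < A i j].

Definition strongly_connected (R : realFieldType) (n : nat) (A : 'M[R]_n) : Prop :=
  forall i j, connect (edge A) i j.

Definition weight_balanced (R : realFieldType) (n : nat) (A : 'M[R]_n) : Prop :=
  forall i, \sum_j A j i = \sum_j A i j.

Definition laplacian (R : realFieldType) (n : nat) (A : 'M[R]_n) : 'M[R]_n :=
  diag_mx (\row_i \sum_j A i j) - A.

Definition sym_part (R : realFieldType) (n : nat) (X : 'M[R]_n) : 'M[R]_n :=
  2^-1 *: (X + X^T).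

Definition diagvec (R : realFieldType) (n : nat) (X : 'M[R]_n) : 'cV[R]_n :=
  \col_i X i i.

Definition basis_vec (R : realFieldType) (n : nat) (i : 'I_n) : 'cV[R]_n :=
  delta_mx i 0.

Definition resistance_mx (R : realFieldType) (n : nat) (X : 'M[R]_n) : 'M[R]_n :=
  \matrix_(a, b) ((basis_vec R a - basis_vec R b)^T *m X
                  *m (basis_vec R a - basis_vec R b)) 0 0.

(* Main.v *)
(** Weight balance gives [x^T L x = 1/2 sum_ij A_ij (x_i - x_j)^2], so strong
    connectivity forces the kernel of [L^T] to consist of constant vectors, and
    [L L^+] is the centering projector [C = I - 1 1^T / n].  If [S] is the
    symmetric part of [X = L^+] and [S x = 0], then with [y = X x] one gets
    [0 = x^T X x = y^T L y], so [y] and hence [x] is constant; therefore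
    [S S^+ = C] too.  As [Omega = zeta 1^T + 1 zeta^T - 2 S], the inverse is then
    verified by block multiplication. *)

Require Import Defs.
From HB Require Import structures.
From mathcomp Require Import all_boot all_order all_algebra.
From mathcomp Require Import reals ring.

Set Implicit Arguments.
Unset Strict Implicit.
Unset Printing Implicit Defensive.

Import Order.TTheory GRing.Theory Num.Theory.
Local Open Scope ring_scope.

(** * Pseudoinverse products and the centering projector *)

Section CenteringProjector.
Variable R : realFieldType.

Definition ones (n : nat) : 'cV[R]_n := const_mx 1.

Definition centering (n : nat) : 'M[R]_n :=
  1%:M - n%:R^-1 *: (ones n *m (ones n)^T).

(** Only one inclusion: the kernel lies in the span of [ones]. The other is always supplied
    separately as [B *m ones n = 0]. *)
Definition const_ker (n : nat) (B : 'M[R]_n) : Prop :=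
  forall x : 'cV[R]_n, B *m x = 0 -> forall i j, x i 0 = x j 0.

Lemma ones_tr_mul_ones n : (ones n)^T *m ones n = n%:R%:M.
Proof.
apply/matrixP => i j; rewrite !ord1 !mxE mulr1n.
by under eq_bigr do rewrite !mxE mulr1; rewrite sumr_const card_ord.
Qed.

Lemma ones_mul_onesE n i j : (ones n *m (ones n)^T) i j = 1.
Proof. by rewrite !mxE big_ord1 !mxE mulr1. Qed.

Lemma const_colE n (x : 'cV[R]_n) :
  (forall i j, x i 0 = x j 0) -> exists c, x = c *: ones n.
Proof.
case: n x => [|n] x xc; first by exists 0; apply/colP => -[].
by exists (x 0 0); apply/colP => i; rewrite !mxE mulr1.
Qed.

Lemma centering_tr n : (centering n)^T = centering n.
Proof. by rewrite /centering !(linearB, linearZ) /= trmx1 trmx_mul trmxK. Qed.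

Lemma mpinv_tr m n (B : 'M[R]_(m, n)) : mpinv B^T = (mpinv B)^T.
Proof.
apply: penrose_unique (mpinvP _) _.
have /and4P[/eqP b1 /eqP b2 /eqP b3 /eqP b4] := mpinvP B.
rewrite /penrose -!trmx_mul !trmxK b3 b4 !eqxx /= !mulmxA.
by rewrite b1 b2 !eqxx.
Qed.

(** Symmetry of [B B^+] gives [B^+ = B^+ (B^+)^T B^T], so [B^+] kills whatever [B^T] kills. *)
Lemma mpinv_mul_ones n (B : 'M[R]_n) :
  B^T *m ones n = 0 -> mpinv B *m ones n = 0.
Proof.
move=> B1; have /and4P[_ /eqP b2 /eqP b3 _] := mpinvP B.
by rewrite -b2 -(mulmxA (mpinv B)) -b3 trmx_mul -!mulmxA B1 !mulmx0.
Qed.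

(** The complement [Q = I - B^+ B] is symmetric and its columns lie in the kernel of [B], hence are
    constant; so all entries of [Q] are equal, and [Q 1 = 1] forces them to be [1/n]. *)
Lemma mpinv_mulVmx n (B : 'M[R]_n) : (0 < n)%N ->
  B *m ones n = 0 -> const_ker B -> mpinv B *m B = centering n.
Proof.
move=> n0 B1 kB; have /and4P[/eqP b1 _ _ /eqP b4] := mpinvP B.
pose Q := 1%:M - mpinv B *m B.
have QT : Q^T = Q by rewrite linearB /= trmx1 b4.
have BQ : B *m Q = 0 by rewrite mulmxBr mulmx1 mulmxA b1 subrr.
have Qcol i k j : Q i j = Q k j.
  have := kB (col j Q); rewrite {1}colE mulmxA BQ mul0mx => /(_ erefl i k).
  by rewrite !mxE.
have Qsym i j : Q i j = Q j i by rewrite -{1}QT mxE.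
have Q1 : Q *m ones n = ones n by rewrite mulmxBl mul1mx -mulmxA B1 mulmx0 subr0.
suff -> : mpinv B *m B = 1%:M - Q.
  congr (_ - _); apply/matrixP => i j.
  rewrite [RHS]mxE ones_mul_onesE mulr1.
  have /colP/(_ i) := Q1; rewrite [LHS]mxE [RHS]mxE.
  under eq_bigr => k _ do rewrite [ones n k 0]mxE mulr1 Qsym (Qcol k j) Qsym.
  rewrite sumr_const card_ord -[LHS]mulr_natr => H.
  have nz : n%:R != 0 :> R by rewrite pnatr_eq0 -lt0n.
  by apply: (mulIf nz); rewrite H mulVf.
by rewrite opprB addrC subrK.
Qed.

Lemma mpinv_mulmxV n (B : 'M[R]_n) : (0 < n)%N ->
  B^T *m ones n = 0 -> const_ker B^T -> B *m mpinv B = centering n.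
Proof.
move=> n0 B1 kB; apply: trmx_inj.
by rewrite trmx_mul -mpinv_tr mpinv_mulVmx // centering_tr.
Qed.

Lemma sym_part_tr n (X : 'M[R]_n) : (sym_part X)^T = sym_part X.
Proof. by rewrite /sym_part linearZ linearD /= trmxK addrC. Qed.

Lemma quad_form_tr n (X : 'M[R]_n) (x : 'cV[R]_n) :
  (x^T *m X^T *m x) 0 0 = (x^T *m X *m x) 0 0.
Proof.
have <- : (x^T *m X *m x)^T = x^T *m X^T *m x by rewrite !trmx_mul trmxK mulmxA.
by rewrite mxE.
Qed.

Lemma quad_form_sym_part n (X : 'M[R]_n) (x : 'cV[R]_n) :
  (x^T *m sym_part X *m x) 0 0 = (x^T *m X *m x) 0 0.
Proof.
rewrite /sym_part -scalemxAr -scalemxAl mulmxDr mulmxDl mxE mxE.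
by rewrite quad_form_tr; field.
Qed.

End CenteringProjector.

(** * Laplacian of a strongly connected balanced digraph *)

Section BalancedLaplacian.
Variables (R : realFieldType) (n : nat) (A : 'M[R]_n).
Hypotheses (hA : weighted_digraph A) (hconn : strongly_connected A).
Hypothesis hbal : weight_balanced A.

Let L := laplacian A.
Let X := mpinv L.

Lemma laplacian_mulE (x : 'cV[R]_n) i :
  (L *m x) i 0 = (\sum_j A i j) * x i 0 - \sum_j A i j * x j 0.
Proof. by rewrite /L /laplacian mulmxBl mul_diag_mx !mxE. Qed.

Lemma laplacian_ones : L *m ones R n = 0.
Proof.
apply/colP => i; rewrite laplacian_mulE !mxE mulr1.
by under [X in _ - X]eq_bigr do rewrite mxE mulr1; rewrite subrr.
Qed.

Lemma laplacian_tr_ones : L^T *m ones R n = 0.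
Proof.
apply/colP => i; rewrite /L /laplacian linearB /= tr_diag_mx mulmxBl mul_diag_mx.
rewrite !mxE mulr1 -hbal.
by under [X in _ - X]eq_bigr do rewrite !mxE mulr1; rewrite subrr.
Qed.

Lemma laplacian_quad_form (x : 'cV[R]_n) :
  2 * (x^T *m L *m x) 0 0 = \sum_i \sum_j A i j * (x i 0 - x j 0) ^+ 2.
Proof.
have -> : \sum_i \sum_j A i j * (x i 0 - x j 0) ^+ 2 =
    \sum_i \sum_j A i j * x i 0 ^+ 2 + \sum_i \sum_j A i j * x j 0 ^+ 2
    - 2 * \sum_i \sum_j A i j * x i 0 * x j 0.
  rewrite mulr_sumr -big_split -sumrB; apply: eq_bigr => i _.
  rewrite mulr_sumr -big_split -sumrB; apply: eq_bigr => j _ /=; ring.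
(* After the exchange, [x_j^2] is weighted by an in-degree; balance turns it into the out-degree, so
   both sums of squares coincide. *)
rewrite [X in _ + X - _]exchange_big /=.
under [X in _ + X - _]eq_bigr do rewrite -mulr_suml hbal mulr_suml.
rewrite -mulr2n -[X in X - _]mulr_natl -mulrBr -mulmxA mxE -sumrB.
congr (_ * _); apply: eq_bigr => i _.
rewrite mxE laplacian_mulE mulrBr -mulr_suml mulr_sumr; congr (_ - _); first by ring.
by apply: eq_bigr => j _; ring.
Qed.

(** A vanishing sum of nonnegative terms makes [x] agree across every edge, hence along every
    directed path. *)
Lemma laplacian_quad_form_eq0 (x : 'cV[R]_n) :
  (x^T *m L *m x) 0 0 = 0 -> forall i j, x i 0 = x j 0.
Proof.
move=> x0; have [A0 _] := hA.
have term_ge0 i j : 0 <= A i j * (x i 0 - x j 0) ^+ 2.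
  by rewrite mulr_ge0 ?sqr_ge0.
have /esym/eqP := laplacian_quad_form x; rewrite x0 mulr0.
rewrite psumr_eq0 => [/allP s0|i _]; last exact: sumr_ge0.
have edge_eq i j : edge A i j -> x i 0 = x j 0.
  move=> /= Aij; have := s0 i (mem_index_enum _); rewrite /= psumr_eq0 //.
  move=> /allP/(_ j (mem_index_enum _)) /=.
  by rewrite mulf_eq0 (gt_eqF Aij) sqrf_eq0 subr_eq0 => /eqP.
move=> i j; have /connectP[p] := hconn i j.
by elim: p i => [|k p IHp] i /= => [_ -> //|/andP[/edge_eq -> /IHp IH] /IH].
Qed.

Lemma laplacian_tr_const_ker : const_ker L^T.
Proof.
move=> x Lx; apply: laplacian_quad_form_eq0.
by rewrite -quad_form_tr -mulmxA Lx mulmx0 mxE.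
Qed.

Lemma mpinv_laplacian_ones : X *m ones R n = 0.
Proof. exact/mpinv_mul_ones/laplacian_tr_ones. Qed.

Lemma mpinv_laplacian_tr_ones : X^T *m ones R n = 0.
Proof. by rewrite -mpinv_tr mpinv_mul_ones // trmxK laplacian_ones. Qed.

Lemma sym_part_mpinv_laplacian_ones : sym_part X *m ones R n = 0.
Proof.
by rewrite -scalemxAl mulmxDl mpinv_laplacian_ones mpinv_laplacian_tr_ones
  addr0 scaler0.
Qed.

Lemma sym_part_mpinv_laplacian_const_ker : (0 < n)%N -> const_ker (sym_part X).
Proof.
move=> n0 x Sx.
have xX0 : (x^T *m X *m x) 0 0 = 0.
  by rewrite -quad_form_sym_part -mulmxA Sx mulmx0 mxE.
pose y := X *m x.
have onesy : (ones R n)^T *m y = 0.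
  by rewrite mulmxA -[_ *m X]trmxK trmx_mul trmxK mpinv_laplacian_tr_ones trmx0 mul0mx.
have Ly : L *m y = centering R n *m x.
  rewrite mulmxA mpinv_mulmxV //; first exact: laplacian_tr_ones.
  exact: laplacian_tr_const_ker.
have [c yc] : exists c, y = c *: ones R n.
  (* With [C] the centering matrix, [y^T L^T y = (C x)^T y = x^T C y = x^T y = x^T X x = 0], where
     [C y = y] because the entries of [y] sum to zero. *)
  apply/const_colE/laplacian_quad_form_eq0; rewrite -quad_form_tr -trmx_mul Ly.
  rewrite trmx_mul centering_tr -mulmxA /centering mulmxBl mul1mx -scalemxAl -mulmxA.
  by rewrite onesy mulmx0 scaler0 subr0 mulmxA.
(* As [y] is constant, [C x = L y = 0], so every entry of [x] equals the mean of [x]. *)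
move: Ly; rewrite yc -scalemxAr laplacian_ones scaler0 mulmxBl mul1mx.
move/esym/subr0_eq => -> i j; rewrite -scalemxAl -mulmxA.
by rewrite !(mxE, big_ord1).
Qed.

End BalancedLaplacian.

(** * The resistance matrix and its bordered inverse *)

Lemma resistance_mxE (R : realFieldType) n (S : 'M[R]_n) : S^T = S ->
  resistance_mx S = diagvec S *m (ones R n)^T + ones R n *m (diagvec S)^T - 2 *: S.
Proof.
move=> ST; apply/matrixP => a b; rewrite mxE [(_ - _)^T]linearB /= mulmxBl mulmxBr !mulmxBl.
have E c d : ((basis_vec R c)^T *m S *m basis_vec R d) 0 0 = S c d.
  by rewrite /basis_vec trmx_delta -rowE -colE !mxE.
have subE (P Q : 'M[R]_1) : (P - Q) 0 0 = P 0 0 - Q 0 0 by rewrite !mxE.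
have Sba : S b a = S a b by rewrite -{1}ST mxE.
rewrite !subE !E Sba !(mxE, big_ord1); ring.
Qed.

(** [K] plays the role of the pseudoinverse of [S]. The top blocks reduce to [1^T p = 1] and
    [1^T K = 0]; the bottom ones use [2 S p = C zeta] and [S K = C], with [C] the centering
    matrix. *)
Lemma bordered_resistance_mulmx (R : realFieldType) n (S K : 'M[R]_n) :
  (0 < n)%N -> S^T = S -> K^T = K -> S *m ones R n = 0 -> K *m ones R n = 0 ->
  S *m K = centering R n ->
  let zeta := diagvec S in
  let p := 2^-1 *: (K *m zeta) + n%:R^-1 *: ones R n in
  let sigma2 := 4^-1 * (zeta^T *m K *m zeta) 0 0
                + n%:R^-1 * ((ones R n)^T *m zeta) 0 0 in
  block_mx 0 (ones R n)^T (ones R n) (resistance_mx S)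
    *m (- 2^-1 *: block_mx (4 * sigma2)%:M (- 2 *: p^T) (- 2 *: p) K)
  = 1%:M :> 'M[R]_(1 + n).
Proof.
move=> n0 ST KT S1 K1 SK zeta p sigma2.
have nz : n%:R != 0 :> R by rewrite pnatr_eq0 -lt0n.
have h2 : - 2^-1 * - 2 = 1 :> R by rewrite mulrNN mulVf ?pnatr_eq0.
have onesK : (ones R n)^T *m K = 0 by rewrite -KT -trmx_mul K1 trmx0.
have onesp : (ones R n)^T *m p = 1%:M.
  rewrite mulmxDr -!scalemxAr mulmxA onesK mul0mx scaler0 add0r ones_tr_mul_ones.
  by rewrite scale_scalar_mx mulVf.
have zetap : zeta^T *m p = (2^-1 * (zeta^T *m K *m zeta) 0 0
    + n%:R^-1 * ((ones R n)^T *m zeta) 0 0)%:M.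
  rewrite [LHS]mx11_scalar; congr (_%:M); rewrite mulmxDr -!scalemxAr mulmxA.
  rewrite [LHS]mxE; congr (_ + _); rewrite mxE //; congr (_ * _).
  by rewrite -[ones R n in LHS]trmxK -trmx_mul mxE.
have Sp : 2 *: (S *m p) = zeta - (n%:R^-1 * ((ones R n)^T *m zeta) 0 0) *: ones R n.
  rewrite mulmxDr -!scalemxAr S1 scaler0 addr0 scalerA mulfV ?pnatr_eq0 // scale1r.
  rewrite mulmxA SK mulmxBl mul1mx -scalemxAl -mulmxA -scalerA.
  by rewrite {1}[_^T *m zeta]mx11_scalar mul_mx_scalar.
rewrite scale_block_mx scale_scalar_mx !scalerA h2 !scale1r.
rewrite mulmx_block !mul0mx !add0r onesp -scalemxAr onesK scaler0.
rewrite resistance_mxE // scalar_mx_block; congr block_mx.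
(* Lower left block: the [zeta] terms of [Omega p] cancel, leaving [(q/2 + 2r/n) 1] with
   [q = zeta^T K zeta] and [r = 1^T zeta]. This is [2 sigma2 1], which fixes the value of
   [sigma2]. *)
- rewrite mul_mx_scalar mulmxBl mulmxDl -!mulmxA onesp zetap mulmx1 mul_mx_scalar.
  rewrite -scalemxAl Sp /sigma2; set q := (_ *m zeta) 0 0; set r := (_ *m zeta) 0 0.
  apply/colP => i; rewrite !mxE.
  by field; rewrite nz.
(* Lower right block: [1 p^T] cancels the term [- 1 zeta^T K / 2] and adds [1 1^T / n], which
   completes [S K = C] to the identity. *)
- rewrite -scalemxAr mulmxBl mulmxDl -(mulmxA zeta) onesK mulmx0 add0r.
  rewrite -scalemxAl SK.
  have -> : p^T = 2^-1 *: (zeta^T *m K) + n%:R^-1 *: (ones R n)^T.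
    by rewrite linearD !linearZ /= trmx_mul KT.
  rewrite mulmxDr -!scalemxAr scalerBr scalerA mulNr mulVf ?pnatr_eq0 //.
  rewrite mulmxA scaleNr scaleN1r opprK /centering.
  by rewrite addrACA subrr add0r addrC subrK.
Qed.

Theorem theorem3p1 (R : realType) (n : nat) (hn : (2 <= n)%N) (A : 'M[R]_n)
    (hA : weighted_digraph A) (hconn : strongly_connected A)
    (hbal : weight_balanced A) :
  let L : 'M[R]_n := laplacian A in
  let Ls : 'M[R]_n := sym_part (mpinv L) in
  let zeta : 'cV[R]_n := diagvec Ls in
  let Omega : 'M[R]_n := resistance_mx Ls in
  let one : 'cV[R]_n := const_mx 1 in
  let p : 'cV[R]_n := 2^-1 *: (mpinv Ls *m zeta) + n%:R^-1 *: one in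
  let sigma2 : R := 4^-1 * (zeta^T *m mpinv Ls *m zeta) 0 0
                    + n%:R^-1 * (one^T *m zeta) 0 0 in
  let M : 'M[R]_(1 + n) := block_mx 0 one^T one Omega in
  M \in unitmx /\
  invmx M = - 2^-1 *: block_mx (4 * sigma2)%:M (- 2 *: p^T)
                               (- 2 *: p) (mpinv Ls).
Proof.
move=> L Ls zeta Omega one p sigma2 M.
have n0 : (0 < n)%N by apply: leq_trans hn.
have LsT : Ls^T = Ls by apply: sym_part_tr.
have Ls1 : Ls *m ones R n = 0 by apply: sym_part_mpinv_laplacian_ones.
have kLs : const_ker Ls by apply: sym_part_mpinv_laplacian_const_ker.
have KT : (mpinv Ls)^T = mpinv Ls by rewrite -mpinv_tr LsT.
have K1 : mpinv Ls *m ones R n = 0 by apply: mpinv_mul_ones; rewrite LsT.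
have LsK : Ls *m mpinv Ls = centering R n by apply: mpinv_mulmxV; rewrite ?LsT.
have MN := bordered_resistance_mulmx n0 LsT KT Ls1 K1 LsK.
(* For square matrices a right inverse suffices; cancelling [M] on the left identifies it with
   [invmx M]. *)
have [uM _] := mulmx1_unit MN; split=> //.
by apply: (can_inj (mulKmx uM)); rewrite mulmxV.
Qed.
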